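(* Let $X$ be a continuum. Then $\mathcal{T}\colon 2^X\to 2^X$ is continuous if and only if there exist a locally connected continuum $Y$ and a monotone and open map $f\colon X\to Y$ such that $\mathcal{T}(A)=f^{-1}(f(A))$ for each $A\in 2^{X}$.
   Context: A continuum is a compact, connected, nonempty metric space; a subcontinuum of $X$ is a subset of $X$ that is a continuum. A map is a continuous function; a map is monotone if the preimages of points are connected. For a continuum $X$, $2^X$ denotes the set of all nonempty closed subsets of $X$ with the Hausdorff metric. Jones' set function $\mathcal{T}$ is defined for every $A\subseteq X$ by $$\mathcal{T}(A)=X\setminus\{x\in X : \text{there is a subcontinuum } W \text{ of } X \text{ with } x\in W^{\circ}\subseteq W\subseteq X\setminus A\},$$ where $W^\circ$ is the interior of $W$ in $X$. If $A\in 2^X$ then $\mathcal{T}(A)\in 2^X$, and continuity of $\mathcal{T}$ refers to its restriction $2^X\to 2^X$. *)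

(* Defs.v *)
From HB Require Import structures.
From mathcomp Require Export all_boot all_order all_algebra.
From mathcomp Require Export all_classical all_reals all_analysis.

Set Implicit Arguments.
Unset Strict Implicit.
Unset Printing Implicit Defensive.

Import Order.TTheory GRing.Theory Num.Theory.

Local Open Scope classical_set_scope.
Local Open Scope ring_scope.

(* The library takes set0 to be connected, so nonemptiness is required
   separately. *)
Definition subcontinuum (X : topologicalType) (W : set X) : Prop :=
  [/\ compact W, connected W & W !=set0].

HB.mixin Record Metric_isContinuum (R : realType) X & Metric R X := {
  continuumT : subcontinuum [set: X]
}.

#[short(type="continuumType")]
HB.structure Definition Continuum (R : realType) :=
  { X of Metric R X & Metric_isContinuum R X }.

Definition jonesT (X : topologicalType) (A : set X) : set X :=
  ~` [set x | exists W : set X,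
        [/\ subcontinuum W, W° x & W `<=` ~` A]].

Definition locally_connected (Y : topologicalType) : Prop :=
  forall (y : Y) (U : set Y), open U -> U y ->
    exists V : set Y, [/\ open V, connected V, V y & V `<=` U].

Definition monotone_map (X Y : topologicalType) (f : X -> Y) : Prop :=
  forall y : Y, connected (f @^-1` [set y]).

Definition open_map (X Y : topologicalType) (f : X -> Y) : Prop :=
  forall U : set X, open U -> open (f @` U).

(* The hyperspace 2^X. *)
Record hyperspace (X : topologicalType) := Hyperspace {
  hyperset :> set X;
  hyperset_closed : closed hyperset;
  hyperset_neq0 : hyperset !=set0
}.
Arguments hyperset_closed {X} h.
Arguments hyperset_neq0 {X} h.

Lemma hyperset_inj (X : topologicalType) : injective (@hyperset X).
Proof.
move=> [A cA A0] [B cB B0] /= AB; case: _ / AB in cB B0 *.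
by congr Hyperspace; exact: Prop_irrelevance.
Qed.

HB.instance Definition _ (X : topologicalType) :=
  gen_eqMixin (hyperspace X).
HB.instance Definition _ (X : topologicalType) :=
  gen_choiceMixin (hyperspace X).

Section hausdorff_metric.
Context {R : realType} {X : continuumType R}.
Implicit Types (A B C : hyperspace X) (r : R).

Definition thickening (A : set X) (r : R) : set X := \bigcup_(a in A) ball a r.

Definition hausdorff_radii (A B : set X) : set R :=
  [set r | [/\ 0 < r, A `<=` thickening B r & B `<=` thickening A r]].

(* The infimum is over a nonempty set because a continuum is bounded. *)
Definition hausdorff_dist (A B : hyperspace X) : R :=
  inf (hausdorff_radii A B).

Lemma continuum_bounded : exists2 M : R, 0 < M & forall x y : X, ball x M y.
Proof.
have [cX _ [x0 _]] := @continuumT R X.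
suff [M M0 hM] : exists2 M : R, 0 < M & forall x : X, ball x0 M x.
  exists (M + M); first exact: addr_gt0.
  by move=> x y; apply: ball_triangle (hM y); apply: ball_sym.
move/compact_near_coveringP: cX => cX.
have /cX : forall x : X, [set: X] x ->
    \forall x' \near x & M \near +oo%R, (fun M x => ball x0 M x) M x'.
  move=> x _; exists (ball x 1, [set M | mdist x0 x + 1 < M]) => /=.
    split; first exact: nbhsx_ballx.
    exact: nbhs_pinfty_gt (num_real _).
  case=> x' M [/= xx' hM]; apply: le_ball (ltW hM) _ _.
  move: xx'; rewrite !ballEmdist /= => xx'.
  by rewrite (le_lt_trans (metric_triangle x0 x x'))// ltrD2l.
move=> hM; have [M [M0 MM]] := filter_ex (filterI (nbhs_pinfty_gt (num_real (0 : R))) hM).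
by exists M => // x; exact: MM.
Qed.

Lemma hausdorff_radii_neq0 A B : hausdorff_radii A B !=set0.
Proof.
have [M M0 hM] := continuum_bounded.
have [[a Aa] [b Bb]] := (hyperset_neq0 A, hyperset_neq0 B).
by exists M; split=> // x _; [exists b|exists a].
Qed.

Lemma hausdorff_radii_has_inf A B : has_inf (hausdorff_radii A B).
Proof.
split; first exact: hausdorff_radii_neq0.
by exists 0 => r [/ltW].
Qed.

Lemma hausdorff_dist_ge0 A B : 0 <= hausdorff_dist A B.
Proof.
by apply: lb_le_inf; [exact: hausdorff_radii_neq0|move=> r [/ltW]].
Qed.

Lemma hausdorff_distxx A : hausdorff_dist A A = 0.
Proof.
apply/eqP; rewrite eq_le hausdorff_dist_ge0 andbT.
apply/ler_addgt0Pl => e e0; rewrite addr0.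
apply: ge_inf; first by case: (hausdorff_radii_has_inf A A).
by split=> // x Ax; exists x => //; exact: ballxx.
Qed.

Lemma hausdorff_dist_lt A B r : hausdorff_dist A B < r ->
  exists2 s, s < r & hausdorff_radii A B s.
Proof.
by move=> /(inf_lt (hausdorff_radii_neq0 A B))[s ? ?]; exists s.
Qed.

Lemma hausdorff_dist0 A B : hausdorff_dist A B = 0 -> A = B.
Proof.
move=> AB0; apply: hyperset_inj.
have sub (C D : hyperspace X) :
    (forall e : R, 0 < e -> C `<=` thickening D e) -> C `<=` D.
  move=> h x Cx; apply: (hyperset_closed D) => V /nbhs_ballP[e /= e0 eV].
  have [d Dd dx] := h _ e0 _ Cx.
  by exists d; split=> //; apply: eV; exact: ball_sym.
have thick (C : set X) s e : s < e -> thickening C s `<=` thickening C e.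
  by move=> /ltW se x [c Cc cx]; exists c => //; exact: le_ball cx.
apply/seteqP; split; apply: sub => e e0 x Cx.
- have [|s se [_ sA sB]] := @hausdorff_dist_lt A B e; first by rewrite AB0.
  exact/(thick _ _ _ se)/sA.
- have [|s se [_ sA sB]] := @hausdorff_dist_lt A B e; first by rewrite AB0.
  exact/(thick _ _ _ se)/sB.
Qed.

Lemma hausdorff_dist_sym A B : hausdorff_dist A B = hausdorff_dist B A.
Proof.
by congr inf; apply/seteqP; split=> r [r0 rA rB].
Qed.

Lemma hausdorff_dist_triangle B A C :
  hausdorff_dist A C <= hausdorff_dist A B + hausdorff_dist B C.
Proof.
have thick (D E F : set X) s t : D `<=` thickening E s ->
    E `<=` thickening F t -> D `<=` thickening F (s + t).
  move=> DE EF x /DE[y /EF[z Fz yz] xy]; exists z => //.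
  by rewrite addrC; exact: ball_triangle xy.
apply/ler_addgt0Pr => e e0.
have e20 : 0 < e / 2 by rewrite divr_gt0.
have [|s se [s0 sA sB]] := @hausdorff_dist_lt A B (hausdorff_dist A B + e / 2).
  by rewrite ltrDl.
have [|t te [t0 tB tC]] := @hausdorff_dist_lt B C (hausdorff_dist B C + e / 2).
  by rewrite ltrDl.
apply: (@le_trans _ _ (s + t)); last first.
  by rewrite (splitr e) addrACA lerD// ltW.
apply: ge_inf; first by case: (hausdorff_radii_has_inf A C).
split; [exact: addr_gt0|exact: thick tB|rewrite addrC; exact: thick sB].
Qed.

End hausdorff_metric.

HB.instance Definition _ (R : realType) (X : continuumType R) :=
  @isMetric.Build R (hyperspace X) (@hausdorff_dist R X)
    hausdorff_distxx hausdorff_dist0 hausdorff_dist_sym hausdorff_dist_triangle.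

Lemma jonesT_closed (X : topologicalType) (A : set X) : closed (jonesT A).
Proof.
apply: open_closedC; rewrite openE => x [W [cW Wx WA]].
by apply: filterS (nbhs_interior Wx) => y Wy; exists W.
Qed.

Lemma sub_jonesT (X : topologicalType) (A : set X) : A `<=` jonesT A.
Proof.
by move=> x Ax [W [_ /interior_subset Wx WA]]; exact: WA Wx Ax.
Qed.

Lemma jonesT_neq0 (X : topologicalType) (A : set X) :
  A !=set0 -> jonesT A !=set0.
Proof. by move=> [x Ax]; exists x; exact: sub_jonesT. Qed.

(* The restriction of jonesT to a self-map of 2^X. *)
Definition jonesT_hyper (X : topologicalType) (A : hyperspace X) :
    hyperspace X :=
  Hyperspace (@jonesT_closed X A) (jonesT_neq0 (hyperset_neq0 A)).

(* Main.v *)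
From HB Require Import structures.
Require Import Defs.

Set Implicit Arguments.
Unset Strict Implicit.
Unset Printing Implicit Defensive.

Import Order.TTheory GRing.Theory Num.Theory.

Local Open Scope classical_set_scope.
Local Open Scope ring_scope.

(** Write T for Jones' function and T(x) for T({x}).  If T is continuous and W
    is a subcontinuum, then X \ W° is a limit of finite subsets of X \ W, whose
    images miss W°; hence T(X \ W°) = X \ W°.  So T is idempotent, and
    "y in T(x)" is a preorder.  Let M be the closed set of its maximal points,
    on which it is an equivalence relation.  Three facts finish the argument.
    - M is connected, and if T(M) = M then M = X.
    - If T(A ∪ B) is the union of two disjoint closed sets around A and B, then
      T(A ∪ B) = T(A) ∪ T(B).
    - T(F) is the union of the T(a), a in F, for finite F in M.  For two points,
      if additivity fails for a in M and z, then T(a) cuts X between the points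
      where it fails and the others, and so does T(m) for maximal points m in
      T({a, z}) close to T(a); this produces a continuum around m that avoids
      a and z.  For more points one moves z towards one of the others.
    By continuity T(M) = M, so the T(x) partition X and T is additive, and
    Y = {T(x)}, a subspace of 2^X, is the quotient sought. *)

(** * Connected and compact sets *)

Section topology.
Context {T : topologicalType}.
Implicit Types A B H K U : set T.

Lemma connected_sub_closed A H K : connected A -> closed H -> closed K ->
  A `<=` H `|` K -> A `&` H `<=` ~` K -> A `<=` H \/ A `<=` K.
Proof.
move=> cA cH cK AHK AHnK.
have [[x AHx]|nAH] := pselect (A `&` H !=set0); last first.
  by right=> x Ax; have [Hx|//] := AHK x Ax; case: nAH; exists x.
left; apply/setIidPl; apply: cA; first by exists x.
- exists (~` K); first exact: closed_openC.
  apply/seteqP; split=> y [Ay].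
    by move=> Hy; split=> //; exact: AHnK.
  by have [|] := AHK y Ay.
- by exists H.
Qed.

Lemma connected_sub_open A U V : connected A -> open U -> open V ->
  A `<=` U `|` V -> A `&` U `<=` ~` V -> A `<=` U \/ A `<=` V.
Proof.
move=> cA oU oV AUV AUnV.
have [||x Ax|x [Ax nVx]|h|h] :=
    @connected_sub_closed A (~` V) (~` U) cA.
- exact: open_closedC.
- exact: open_closedC.
- by have [Vx|nVx] := pselect (V x); [right=> Ux; exact: (AUnV x)|left].
- by have [Ux|//] := AUV x Ax; apply.
- by left=> x Ax; have [//|Vx] := AUV x Ax; case: (h x Ax).
- by right=> x Ax; have [Ux|//] := AUV x Ax; case: (h x Ax).
Qed.

(** Each half of a separation of a closed set is itself closed, since its closure stays in the set
    and misses the other half. *)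
Lemma closed_connected A : closed A ->
  (forall H K, closed H -> closed K -> H !=set0 -> K !=set0 ->
     H `<=` ~` K -> A = H `|` K -> False) -> connected A.
Proof.
move=> cA hA; apply: contrapT => /connectedPn[E [E0 AE [E1 E2]]].
have cE b : closed (E b).
  move=> x Ex; have Ax : A x.
    by apply: cA; apply: closureS Ex; rewrite AE; case: b; [right|left].
  have : ~ E (~~ b) x.
    move=> nEx; case: b Ex nEx => Ex nEx.
      by suff : set0 x by []; rewrite -E2.
    by suff : set0 x by []; rewrite -E1.
  by move: Ax; rewrite AE => -[]; case: b {Ex}.
apply: (hA (E false) (E true)) => // x Ef Et.
by suff : set0 x by []; rewrite -E1; split=> //; exact: subset_closure.
Qed.

Lemma compact_ind (P : set T -> Prop) K : compact K ->
  P set0 -> (forall A B, P A -> P B -> P (A `|` B)) ->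
  (forall A B, A `<=` B -> P B -> P A) ->
  (forall x, K x -> exists2 U, nbhs x U & P U) -> P K.
Proof.
move=> /compact_near_coveringP cK P0 PU Psub Ploc.
(* [F] collects the families that contain every large enough set with [P]; near-covering compactness
   along [F] yields one such set covering [K]. *)
pose F : set_system (set T) := [set S | exists2 A, P A &
  forall B, P B -> A `<=` B -> S B].
have FF : Filter F.
  split; first by exists set0.
  - move=> S1 S2 [A1 PA1 h1] [A2 PA2 h2]; exists (A1 `|` A2); first exact: PU.
    move=> B PB AB; split; [apply: h1|apply: h2] => // x Ax; apply: AB;
      by [left|right].
  - by move=> S1 S2 S12 [A PA h]; exists A => // B PB AB; apply: S12; exact: h.
have [A PA /(_ A PA) KA] : F [set A | K `<=` A].
  apply: (cK _ F (fun A x => A x)) => x /Ploc[U nU PU1].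
  exists (U, [set B | U `<=` B]) => /=.
    by split=> //; exists U.
  by case=> y B [/= Uy]; apply.
by apply: Psub PA; exact: KA.
Qed.

(* Splitting off clopen pieces stops after at most [size s] steps. *)
Lemma connected_clopen_piece A (s : seq (set T)) x : closed A ->
  A x ->
  (forall H K, closed H -> closed K -> H !=set0 -> H `<=` ~` K ->
     A = H `|` K -> exists2 V, V \in s & V `<=` H /\ V !=set0) ->
  exists H K, [/\ closed H, closed K, H `<=` ~` K, A = H `|` K &
    connected H /\ H x].
Proof.
move=> cA Ax hA.
(* [c H] counts the nonempty members of [s] inside [H]. It drops when [H2] moves over to [K],
   because [H2] contains such a member, which cannot lie in [H1]. *)
pose c (H : set T) := count (fun V => `[< V `<=` H /\ V !=set0 >]) s.
suff gen n : forall H K, (c H < n)%N -> closed H -> closed K -> H `<=` ~` K ->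
    A = H `|` K -> H x -> exists H K, [/\ closed H, closed K, H `<=` ~` K,
      A = H `|` K & connected H /\ H x].
  by apply: (gen (c A).+1 A set0) => //;
    [exact: closed0|by move=> ? ? []|by rewrite setU0].
elim: n => // n IHn H K cHn cH cK HK AHK Hx.
have [coH|ncH] := pselect (connected H); first by exists H, K.
apply: contrapT => hno; apply: ncH; apply: closed_connected => //.
suff gen2 H1 H2 : closed H1 -> closed H2 -> H2 !=set0 ->
    H1 `<=` ~` H2 -> H = H1 `|` H2 -> H1 x -> False.
  move=> H1 H2 cH1 cH2 H10 H20 H12 HE; move: (Hx); rewrite HE => -[H1x|H2x].
    exact: (gen2 H1 H2).
  apply: (gen2 H2 H1) => //; last by rewrite setUC.
  by move=> y H2y H1y; exact: (H12 y).
move=> cH1 cH2 H20 H12 HE H1x; apply: hno.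
have H1H : H1 `<=` H by rewrite HE; left.
have H2H : H2 `<=` H by rewrite HE; right.
apply: (IHn H1 (H2 `|` K)) => //.
- have [||V Vs [VH2 [y Vy]]] := hA H2 (H1 `|` K) cH2 (closedU cH1 cK) H20.
  + move=> y H2y [H1y|Ky]; first exact: (H12 y).
    by apply: (HK y) => //; exact: H2H.
  + by rewrite AHK HE setUA (setUC H2).
  rewrite -ltnS; apply: leq_trans cHn; rewrite ltnS /c.
  have -> : count (fun V => `[< V `<=` H /\ V !=set0 >]) s =
      addn (count (fun V => `[< V `<=` H1 /\ V !=set0 >]) s)
      (count (fun V => `[< V `<=` H /\ V !=set0 >] &&
            ~~ `[< V `<=` H1 /\ V !=set0 >]) s).
    rewrite -count_predUI [X in addn _ X](_ : _ = 0%N) ?addn0; last first.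
      by rewrite -[RHS](count_pred0 s); apply: eq_count => W /=; case: asboolP;
         rewrite ?andbF.
    apply: eq_count => W /=;
      case: (asboolP (W `<=` H1 /\ _)) => [[WH1 W0]|_] /=.
      by apply/asboolP; split=> //; exact: subset_trans H1H.
    by rewrite andbT.
  rewrite -[X in (X < _)%N]addn0 ltn_add2l -has_count.
  apply/hasP; exists V => //.
  apply/andP; split; first by apply/asboolP; split;
    [exact: subset_trans H2H|exists y].
  by apply/asboolP => -[/(_ y Vy) H1y _]; apply: (H12 y H1y); exact: VH2.
- exact: closedU.
- by move=> y H1y [H2y|Ky]; [exact: (H12 y)|apply: (HK y) => //; exact: H1H].
- by rewrite AHK HE setUA.
Qed.

End topology.

(** * Jones' function on a continuum *)

Lemma jonesT1xx (X : topologicalType) (x : X) : jonesT [set x] x.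
Proof. exact: sub_jonesT. Qed.
Arguments jonesT1xx {X} x.

Section jones.
Context {R : realType} {X : continuumType R}.
Implicit Types A B C D F W U V : set X.

Notation T := (@jonesT X).

Lemma continuum_hausdorff : hausdorff_space X.
Proof. exact: metric_hausdorff. Qed.

Lemma closed_compact A : closed A -> compact A.
Proof.
move=> cA; have [cX _ _] := @continuumT R X.
exact: subclosed_compact cA cX _.
Qed.

Lemma compact_closedX A : compact A -> closed A.
Proof. by apply: compact_closed; exact: continuum_hausdorff. Qed.

Lemma closed_point (x : X) : closed [set x].
Proof.
apply: accessible_closed_set1; apply: hausdorff_accessible.
exact: continuum_hausdorff.
Qed.

Lemma subcontinuum_closed W : subcontinuum W -> closed W.
Proof. by case=> /compact_closedX. Qed.

Lemma closed_subcontinuum W : closed W -> connected W -> W !=set0 ->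
  subcontinuum W.
Proof. by move=> /closed_compact. Qed.

Lemma separate_closed A B : closed A -> closed B -> A `<=` ~` B ->
  exists U V, [/\ open U, open V, A `<=` U, B `<=` V & U `<=` ~` V].
Proof.
move=> cA cB AB.
have [U [V [oU oV AU BV UV]]] :=
  (@normal_openP R X).1 (@pseudometric_normal R X) A B cA cB
    (proj2 (disjoints_subset _ _) AB).
by exists U, V; split=> //; exact/disjoints_subset.
Qed.

Lemma closure_disjoint U V : open V -> U `<=` ~` V -> closure U `<=` ~` V.
Proof.
move=> oV UV; have /closure_id -> : closed (~` V) by exact: open_closedC.
exact: closureS.
Qed.

Lemma clopen_continuum U : open U -> closed U -> U !=set0 -> U = setT.
Proof.
move=> oU cU U0; have [_ cX _] := @continuumT R X.
by apply: cX => //; exists U => //; rewrite setTI.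
Qed.

Lemma jonesTNP A x : ~ T A x <->
  exists W, [/\ subcontinuum W, W° x & W `<=` ~` A].
Proof. by split=> [/contrapT//|W]; apply. Qed.

Lemma jonesTS A B : A `<=` B -> T A `<=` T B.
Proof.
move=> AB x Ax [W [cW Wx WB]]; apply: Ax; exists W; split=> //.
by move=> y /WB nBy /AB.
Qed.

Lemma jonesT0 : T set0 = set0.
Proof.
rewrite -subset0 => x; apply; exists setT; split=> //.
- exact: continuumT.
- by rewrite interiorT.
- by move=> y _ [].
Qed.

Lemma jonesT_openN A x y : closed A -> ~ T (A `|` [set x]) y ->
  exists U V, [/\ open U, open V, U x, V y &
    forall x' y', U x' -> V y' -> ~ T (A `|` [set x']) y'].
Proof.
move=> cA /jonesTNP[W [cW Wy WA]]; exists (~` W), W°; split=> //.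
- by apply: closed_openC; exact: subcontinuum_closed.
- exact: open_interior.
- by move=> Wx; apply: (WA x Wx); right.
move=> x' y' nWx' Wy'; apply; exists W; split=> // z Wz [Az|zx'].
  by apply: (WA z Wz); left.
by apply: nWx'; rewrite -zx'.
Qed.

(** Upper semicontinuity: the exclusion of each point of the compact set [F] persists near [x], and
    finitely many of these neighbourhoods suffice. *)
Lemma open_jonesT_disjoint A F : closed A -> closed F ->
  open [set x | T (A `|` [set x]) `<=` ~` F].
Proof.
move=> cA cF; rewrite openE => x /= hx.
have /compact_near_coveringP cov := closed_compact cF.
have : \forall x' \near x, F `<=` (fun y => ~ T (A `|` [set x']) y).
  apply: (cov _ (nbhs x) (fun x' y => ~ T (A `|` [set x']) y)) => y Fy.
  have [|U [V [oU oV Ux Vy UV]]] := @jonesT_openN A x y cA.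
    by move=> /hx; exact.
  exists (V, U) => /=; first by split; apply: open_nbhs_nbhs.
  by case=> y' x' [/= Vy' Ux']; exact: UV.
by apply: filterS => x' h y Ty Fy; exact: (h y).
Qed.

Lemma open_jonesT_sub A U : closed A -> open U ->
  open [set x | T (A `|` [set x]) `<=` U].
Proof.
move=> cA /open_closedC cU; rewrite -[U]setCK.
exact: open_jonesT_disjoint.
Qed.

(** For [p] in [C] outside [T A], cut a neighbourhood [U] of [D] away from a witness [W]. The rest,
    together with finitely many subcontinua covering the frontier of [U], misses [A] and [B] and has
    a connected clopen piece around [p], which is a witness against both sets. *)
Lemma jonesT_separated A B C D : closed A -> closed B -> closed C -> closed D ->
  T (A `|` B) = C `|` D -> C `<=` ~` D -> A `<=` C -> B `<=` D -> C `<=` T A.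
Proof.
move=> cA cB cC cD TE CD AC BD p Cp; apply: contrapT => /jonesTNP[W [sW Wp WA]].
have cW := subcontinuum_closed sW.
have [U [V [oU oV DU CV UV]]] : exists U V,
    [/\ open U, open V, D `<=` U, C `<=` V & U `<=` ~` V].
  by apply: separate_closed => // x Dx /CD; exact.
have clUV := closure_disjoint oV UV.
pose bU := closure U `\` U.
have cbU : closed bU.
  by apply: closedI; [exact: closed_closure|exact: open_closedC].
(* The frontier of [U] misses [C] and [D], so each of its points has a witness off [A] and [B]. *)
have [s sP sbU] : exists2 s : seq (set X),
    (forall K, K \in s -> subcontinuum K /\ K `<=` ~` (A `|` B)) &
    bU `<=` \bigcup_(K in [set` s]) K.
  apply: (compact_ind (P := fun E => exists2 s : seq (set X),
    (forall K, K \in s -> subcontinuum K /\ K `<=` ~` (A `|` B)) &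
    E `<=` \bigcup_(K in [set` s]) K) (closed_compact cbU)).
  - by exists [::].
  - move=> E1 E2 [s1 h1 sE1] [s2 h2 sE2]; exists (s1 ++ s2).
      by move=> K; rewrite mem_cat => /orP[/h1|/h2].
    move=> x [/sE1|/sE2] [K /= Ks Kx]; exists K => //=;
      by rewrite mem_cat Ks ?orbT.
  - by move=> E1 E2 E12 [s h sE]; exists s => // x /E12/sE.
  - move=> x [clUx nUx].
    have /jonesTNP[K [cK Kx KAB]] : ~ T (A `|` B) x.
      by rewrite TE => -[/CV|/DU//]; exact: clUV.
    exists K°; first exact: open_nbhs_nbhs (conj (open_interior _) Kx).
    exists [:: K]; first by move=> L; rewrite inE => /eqP ->.
    by move=> y /interior_subset Ky; exists K => //=; rewrite inE.
pose S := \bigcup_(K in [set` s]) K.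
have cS : closed S.
  apply: closed_bigcup => [|K Ks]; first exact: finite_seq.
  by apply: subcontinuum_closed; case: (sP K Ks).
pose E := (W `\` U) `|` S.
have cE : closed E.
  by apply: closedU => //; apply: closedI => //; exact: open_closedC.
have EAB : E `<=` ~` (A `|` B).
  move=> x [[Wx nUx]|[K Ks Kx]]; last by have [_] := sP K Ks; exact.
  by move=> [/(WA x Wx)//|/BD/DU].
have nclUp : ~ closure U p by move=> /clUV; apply; exact: CV.
have Ep : (W° `&` ~` closure U) `<=` E.
  move=> x [/interior_subset Wx nUx]; left; split=> // Ux.
  exact/nUx/subset_closure.
have oG : open (W° `&` ~` closure U).
  by apply: openI; [exact: open_interior|apply: closed_openC];
    exact: closed_closure.
have [||H [K [cH cK HK EHK [coH Hp]]]] :=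
  connected_clopen_piece (s := s) cE (x := p).
- exact: Ep.
(* A piece containing no member of [s] stays off the closure of [U], so it is clopen in [W] and
   equals [W]; but then [W] itself misses [B]. *)
- move=> H K cH cK H0 HK EHK; apply: contrapT => hno.
  have HW : H `<=` W `\` closure U.
    move=> x Hx; have : E x by rewrite EHK; left.
    have nSx : ~ S x.
      move=> [L Ls Lx]; have [[cL coL L0] LAB] := sP L Ls.
      have LE : L `<=` H `|` K by rewrite -EHK => y Ly; right; exists L.
      have [|LH|LK] := connected_sub_closed coL cH cK LE.
      + by move=> y [_]; exact: HK.
      + by apply: hno; exists L.
      + exact: (HK x Hx (LK x Lx)).
    by move=> [[Wx nUx]|//]; split=> // clUx; apply: nSx; exact: sbU.
  have HWE : H = W.
    case: sW => _ coW _; apply: coW => //; last first.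
      by exists H => //; apply/esym/setIidPr => x /HW[].
    exists (~` closure U `&` ~` K).
      by apply: openI; apply: closed_openC => //; exact: closed_closure.
    apply/seteqP; split=> x.
      by move=> Hx; have [Wx nUx] := HW x Hx; split=> //; split=> //; exact: HK.
    move=> [Wx [nUx nKx]]; have : E x by left; split=> // /subset_closure.
    by rewrite EHK => -[].
  have : T (A `|` B) p by rewrite TE; left.
  apply; exists W; split=> // x Wx [/(WA x Wx)//|/BD/DU Ux].
  by move: (Wx); rewrite -HWE => /HW[_]; apply; exact: subset_closure.
have : T (A `|` B) p by rewrite TE; left.
apply; exists H; split.
- by apply: closed_subcontinuum => //; exists p.
- have : nbhs p ((W° `&` ~` closure U) `&` ~` K).
    apply: open_nbhs_nbhs; split.
      by apply: openI => //; exact: closed_openC.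
    by do 2?split=> //; exact: HK.
  by apply: filterS => x [/Ep]; rewrite EHK => -[].
- by move=> x Hx; apply: EAB; rewrite EHK; left.
Qed.

(** The part of a separation that does not contain [x] would lie in [T set0], which is empty. *)
Lemma jonesT1_connected x : connected (T [set x]).
Proof.
apply: closed_connected; first exact: jonesT_closed.
suff gen H K : closed H -> closed K -> K !=set0 ->
    H `<=` ~` K -> T [set x] = H `|` K -> H x -> False.
  move=> H K cH cK H0 K0 HK TE.
  have : T [set x] x by exact: sub_jonesT.
  rewrite TE => -[Hx|Kx]; first exact: (gen H K).
  apply: (gen K H) => //; last by rewrite setUC.
  by move=> y Ky /HK; exact.
move=> cH cK [y Ky] HK TE Hx.
have : T set0 y.
  apply: (@jonesT_separated set0 [set x] K H) => //.
  - exact: closed0.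
  - exact: closed_point.
  - by rewrite set0U TE setUC.
  - by move=> z Kz /HK; exact.
  - by move=> z ->.
by rewrite jonesT0.
Qed.

End jones.

(** * Maximal points when T is continuous *)

Section continuous_jones.
Context {R : realType} {X : continuumType R}.
Context (Tcont : continuous (fun A : hyperspace X => jonesT_hyper A)).
Implicit Types A B C D F W U V Z : set X.

Notation T := (@jonesT X).

(** Lower semicontinuity, the half of continuity that is not automatic, with the Hausdorff distance
    unfolded into inclusions of thickenings. *)
Lemma jonesT_lsc A V : closed A -> A !=set0 -> open V -> T A `&` V !=set0 ->
  exists2 e : R, 0 < e & forall B, closed B -> B !=set0 ->
    B `<=` thickening A e -> A `<=` thickening B e -> T B `&` V !=set0.
Proof.
move=> cA A0 oV [x [TAx Vx]]; pose hA := Hyperspace cA A0.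
have /nbhs_ballP[r /= r0 rV] : nbhs x V by exact: open_nbhs_nbhs.
have /nbhs_ballP[d /= d0 dA] := Tcont (nbhsx_ballx (jonesT_hyper hA) r r0).
(* The inclusions bound the infimum only weakly; halving makes the distance strictly less than
   [d]. *)
exists (d / 2) => [|B cB B0 BA AB]; first by rewrite divr_gt0.
pose hB := Hyperspace cB B0.
have /dA : ball hA d hB.
  rewrite ballEmdist /=; apply: (@le_lt_trans _ _ (d / 2)); last first.
    by rewrite ltr_pdivrMr// ltr_pMr// ltr1n.
  apply: ge_inf; first by case: (hausdorff_radii_has_inf hA hB).
  by split=> //; rewrite divr_gt0.
rewrite /= ballEmdist /= => /hausdorff_dist_lt[q qr [q0 qA _]].
have [b Tb bx] := qA x TAx; exists b; split=> //.
by apply: rV; apply/ball_sym/(le_ball (ltW qr)).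
Qed.

Lemma seq_closed (s : seq X) : closed [set` s].
Proof.
have /accessible_finite_set_closed : accessible_space X.
  by apply: hausdorff_accessible; exact: continuum_hausdorff.
by apply; exact: finite_seq.
Qed.

(** Finite subsets of [D] approximate its closure in the Hausdorff metric, so lower semicontinuity
    applies. *)
Lemma jonesT_finite D V : open V -> T (closure D) `&` V !=set0 ->
  exists2 s : seq X, (forall x, x \in s -> D x) & T [set` s] `&` V !=set0.
Proof.
move=> oV TDV.
have D0 : closure D !=set0.
  apply/set0P/eqP => D0; move: TDV; rewrite D0 jonesT0 => -[x []].
  by [].
have [e e0 he] := jonesT_lsc (@closed_closure _ D) D0 oV TDV.
have [s sD Ds] : exists2 s : seq X, (forall x, x \in s -> D x) &
    closure D `<=` thickening [set` s] e.
  apply: (compact_ind (P := fun E => exists2 s : seq X,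
    (forall x, x \in s -> D x) & E `<=` thickening [set` s] e)
    (closed_compact (@closed_closure _ D))).
  - by exists [::].
  - move=> E1 E2 [s1 h1 E1s] [s2 h2 E2s]; exists (s1 ++ s2).
      by move=> x; rewrite mem_cat => /orP[/h1|/h2].
    by move=> x [/E1s|/E2s] [y /= ys yx]; exists y => //=;
      rewrite mem_cat ys ?orbT.
  - by move=> E1 E2 E12 [s h Es]; exists s => // x /E12/Es.
  - move=> x Dx; have e20 : 0 < e / 2 by rewrite divr_gt0.
    have [y [Dy xy]] := Dx _ (nbhsx_ballx x _ e20).
    exists (ball x (e / 2)); first exact: nbhsx_ballx.
    exists [:: y]; first by move=> z; rewrite inE => /eqP ->.
    move=> z xz; exists y; first by rewrite /= inE.
    by rewrite (splitr e); apply: ball_triangle xz; exact: ball_sym.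
exists s => //; apply: he => //; first exact: seq_closed.
  by case: D0 => x /Ds[y ys _]; exists y.
move=> x xs; exists x; last exact: ballxx.
exact/subset_closure/sD.
Qed.

Lemma jonesT_interiorC W : subcontinuum W -> T (~` W°) = ~` W°.
Proof.
move=> cW; apply/seteqP; split; last exact: sub_jonesT.
move=> x Tx Wx; rewrite -closure_setC in Tx.
have [s sW [y [Ty Wy]]] := @jonesT_finite (~` W) W° (@open_interior _ _)
  (ex_intro _ x (conj Tx Wx)).
by apply: Ty; exists W; split=> // z Wz /sW.
Qed.

Lemma jonesT_subC A W : subcontinuum W -> A `<=` ~` W° -> T A `<=` ~` W°.
Proof. by move=> cW AW; rewrite -(jonesT_interiorC cW); exact: jonesTS. Qed.

(** The interior of a witness off [A] misses [T A], hence [B], and by [jonesT_subC] also [T B]. *)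
Lemma jonesT_idem A B : B `<=` T A -> T B `<=` T A.
Proof.
move=> BA x Bx; apply: contrapT => /jonesTNP[W [cW Wx WA]].
apply: (jonesT_subC cW _ Bx Wx) => y /BA Ay Wy; apply: Ay.
by exists W.
Qed.

Lemma jonesTN_sub A x : ~ T A x ->
  exists W, [/\ subcontinuum W, W° x & W `<=` ~` T A].
Proof.
move=> nAx; apply/jonesTNP => TAx; apply: nAx.
by apply: jonesT_idem TAx.
Qed.

(** The interior of a subcontinuum is a lower set of the preorder, as its complement is fixed by
    [T]. *)
Lemma jonesT1_interior W x y : subcontinuum W -> T [set x] y -> W° y -> W° x.
Proof.
move=> cW Txy Wy; apply: contrapT => nWx.
by apply: (jonesT_subC cW _ Txy Wy) => _ ->.
Qed.

Lemma jonesT1_trans x y : T [set x] y -> T [set y] `<=` T [set x].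
Proof. by move=> Txy; apply: jonesT_idem => _ ->. Qed.

Lemma open_jonesT_meet A V : closed A -> open V ->
  open [set x | T (A `|` [set x]) `&` V !=set0].
Proof.
move=> cA oV; rewrite openE => x /= hx.
have [||e e0 he] := jonesT_lsc _ _ oV hx.
- by apply: closedU => //; exact: closed_point.
- by exists x; right.
apply: filterS (nbhsx_ballx x _ e0) => y xy; apply: he.
- by apply: closedU => //; exact: closed_point.
- by exists y; right.
- move=> z [Az|->]; first by exists z; [left|exact: ballxx].
  by exists x => //; right.
- move=> z [Az|->]; first by exists z; [left|exact: ballxx].
  by exists y; [right|exact: ball_sym].
Qed.

Lemma open_jonesT1_meet V : open V -> open [set x | T [set x] `&` V !=set0].
Proof.
move=> /(open_jonesT_meet closed0).
by under [X in open X]eq_set do rewrite set0U.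
Qed.

Lemma open_jonesT1_disjoint F : closed F -> open [set x | T [set x] `<=` ~` F].
Proof.
move=> /(open_jonesT_disjoint closed0).
by under [X in open X]eq_set do rewrite set0U.
Qed.

Lemma open_jonesT1_sub U : open U -> open [set x | T [set x] `<=` U].
Proof. by move=> /open_closedC/open_jonesT1_disjoint; rewrite setCK. Qed.

Lemma closure_jonesT A U F : closed A -> closed F ->
  (forall x, U x -> T (A `|` [set x]) `<=` F) ->
  forall x, closure U x -> T (A `|` [set x]) `<=` F.
Proof.
move=> cA cF UF x Ux y Ty; apply: contrapT => nFy.
have oF := closed_openC cF.
have /Ux[z [Uz [w [Tw]]]] :
    nbhs x [set x' | T (A `|` [set x']) `&` ~` F !=set0].
  by apply: open_nbhs_nbhs; split; [exact: open_jonesT_meet|exists y].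
by apply; exact: UF Tw.
Qed.

Lemma closure_jonesT1 U F : closed F ->
  (forall x, U x -> T [set x] `<=` F) ->
  forall x, closure U x -> T [set x] `<=` F.
Proof.
move=> cF UF x Ux; rewrite -(set0U [set x]).
apply: (closure_jonesT (U := U)) => // [|y Uy]; first exact: closed0.
by rewrite set0U; exact: UF.
Qed.

(** Zorn's lemma on [Z]: along a chain the closed sets [T [set s]], cut with [Z], decrease, and by
    compactness they have a cluster point, which bounds the chain. *)
Lemma jonesT1_maximal Z : closed Z -> Z !=set0 ->
  exists z, Z z /\ forall y, Z y -> T [set z] y -> T [set y] z.
Proof.
move=> cZ [z0 Zz0].
pose S := {x : X | Z x}.
pose le (x y : S) : bool := `[< T [set sval x] (sval y) >].
have [||A totA|[z Zz] hz] := @ZL_preorder S (exist _ z0 Zz0) le.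
- by move=> x; apply/asboolP; exact: jonesT1xx.
- move=> x y z /asboolP xy /asboolP yz; apply/asboolP.
  exact: (jonesT1_trans xy).
- have [[a Aa]|A0] := pselect (A !=set0); last first.
    by exists (exist _ z0 Zz0) => s As; case: A0; exists s.
  pose G := filter_from A (fun s => Z `&` T [set sval s]).
  have GG : ProperFilter G.
    apply: filter_from_proper; last first.
      move=> s As; exists (sval s); split; [exact: svalP|exact: jonesT1xx].
    apply: filter_from_filter; first by exists a.
    move=> s1 s2 As1 As2.
    have [/asboolP s12|/asboolP s21] := totA _ _ As1 As2.
      exists s2 => // x [Zx Tx]; split=> //; split=> //.
      exact: (jonesT1_trans s12).
    exists s1 => // x [Zx Tx]; split=> //; split=> //.
    exact: (jonesT1_trans s21).
  have [|p [Zp Gp]] := closed_compact cZ GG.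
    by exists a => // x [].
  exists (exist _ p Zp) => s As; apply/asboolP => /=.
  apply: (@jonesT_closed X [set sval s]) => U nU.
  have [|x [[Zx Tx] Ux]] := Gp (Z `&` T [set sval s]) U _ nU.
    by exists s.
  by exists x.
exists z; split=> // y Zy Tzy.
have := hz (exist _ y Zy); rewrite /le /= => h.
by apply/asboolP; apply: h; apply/asboolP.
Qed.

Definition jonesT_max : set X := [set x | forall y, T [set x] y -> T [set y] x].

Notation M := jonesT_max.

Lemma jonesT_max_eq x y : M x -> T [set x] y -> T [set y] = T [set x].
Proof.
move=> Mx Txy; apply/seteqP; split; apply: jonesT1_trans => //.
exact: Mx.
Qed.

Lemma jonesT_max_up x y : M x -> T [set x] y -> M y.
Proof.
move=> Mx Txy z; rewrite (jonesT_max_eq Mx Txy) => Txz.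
by rewrite (jonesT_max_eq Mx Txz).
Qed.

Lemma jonesT_max_disjoint a z : M a -> ~ T [set z] a ->
  T [set z] `<=` ~` T [set a].
Proof.
move=> Ma nza y Tzy Tay; apply: nza; apply: (jonesT1_trans Tzy).
exact: Ma.
Qed.

Lemma jonesT_max_above x : exists2 m, M m & T [set x] m.
Proof.
have [|m [Txm hm]] := jonesT1_maximal (@jonesT_closed X [set x]).
  by exists x; exact: jonesT1xx.
by exists m => // y Tmy; apply: hm => //; exact: (jonesT1_trans Txm).
Qed.

(** If [y] is in [T [set x]] but not conversely, lower semicontinuity gives each maximal [z] near
    [x] a point [w] of [T [set z]] near [y], and [z] is still outside [T [set w]]. *)
Lemma jonesT_max_closed : closed M.
Proof.
move=> x Mx y Txy; apply: contrapT => nTyx.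
have [|U [V [oU oV Uy Vx UV]]] := @jonesT_openN _ _ set0 y x closed0.
  by rewrite set0U.
have /Mx[z [Mz [Vz [w [Tzw Uw]]]]] :
    nbhs x (V `&` [set x' | T [set x'] `&` U !=set0]).
  apply: open_nbhs_nbhs; split; last by split=> //; exists y.
  by apply: openI => //; exact: open_jonesT1_meet.
apply: (UV w z) => //; rewrite set0U.
exact: Mz.
Qed.

(* If the maximal points split into [P] and [Q], a point maximal among those
   whose [T] meets both pieces contradicts lower semicontinuity. *)
Lemma jonesT_max_connected : connected M.
Proof.
apply: closed_connected; first exact: jonesT_max_closed.
move=> P Q cP cQ [p Pp] [q Qq] PQ ME.
have PM x : P x -> M x by rewrite ME; left.
have QM x : Q x -> M x by rewrite ME; right.
have side x : M x -> T [set x] `<=` P \/ T [set x] `<=` Q.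
  move=> Mx; apply: connected_sub_closed => //.
  - exact: jonesT1_connected.
  - by move=> y /(jonesT_max_up Mx); rewrite ME.
  - by move=> y [_]; exact: PQ.
pose P' := [set x | T [set x] `<=` ~` Q].
pose Q' := [set x | T [set x] `<=` ~` P].
have oP' : open P' by exact: open_jonesT1_disjoint.
have oQ' : open Q' by exact: open_jonesT1_disjoint.
have PP' x : P x -> P' x.
  move=> Px y Txy Qy; have [/(_ y Txy) Py|/(_ x (jonesT1xx x))] :=
    side x (PM x Px).
    exact: (PQ y).
  exact: PQ.
have QQ' x : Q x -> Q' x.
  move=> Qx y Txy Py; have [/(_ x (jonesT1xx x)) Px|/(_ y Txy)] :=
    side x (QM x Qx).
    exact: (PQ x).
  exact: PQ.
have PQ' x : P' x -> ~ Q' x.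
  move=> P'x Q'x; have [m] := jonesT_max_above x.
  by rewrite ME => -[Pm /Q'x//|Qm /P'x].
pose Z := ~` (P' `|` Q').
have cZ : closed Z by apply: open_closedC; exact: openU.
have Z0 : Z !=set0.
  apply: contrapT => nZ.
  have PQT x : P' x \/ Q' x by apply: contrapT => nx; apply: nZ; exists x.
  have P'T : P' = setT.
    apply: clopen_continuum => //; last by exists p; exact: PP'.
    rewrite (_ : P' = ~` Q'); first exact: open_closedC.
    by apply/seteqP; split=> x; [exact: PQ'|case: (PQT x)].
  have : P' q by rewrite P'T.
  by move=> /(_ q (jonesT1xx q)).
have [z [Zz hz]] := jonesT1_maximal cZ Z0.
have [r Pr Tzr] : exists2 r, P r & T [set z] r.
  apply: contrapT => h; apply: Zz; right=> r Tzr Pr; apply: h.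
  by exists r.
have [t Qt Tzt] : exists2 t, Q t & T [set z] t.
  apply: contrapT => h; apply: Zz; left=> t Tzt Qt; apply: h.
  by exists t.
have TP' x : P' x -> T [set x] `<=` ~` Q'.
  move=> P'x y Txy; apply: PQ' => w Tyw; apply: P'x.
  exact: (jonesT1_trans Txy).
have clPQ : closure P' `<=` ~` Q'.
  by apply: closure_disjoint.
(* A frontier point [w] of [P'] in [T [set z]] lies in [Z], so maximality of [z] puts [t] into [T
   [set w]]. But [w] is a limit of points whose [T] misses [Q'], which contains [t]. *)
have clT : closure P' `&` T [set z] `<=` P'.
  move=> w [P'w Tzw]; apply: contrapT => nP'w.
  have Zw : Z w by move=> [//|]; exact: clPQ.
  have Twz := hz w Zw Tzw.
  have : ~ Q' t.
    apply: (closure_jonesT1 (U := P') _ TP' P'w); first exact: open_closedC.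
    exact: (jonesT1_trans Twz).
  by apply; exact: QQ'.
have : T [set z] `&` P' = T [set z].
  apply: (@jonesT1_connected R X z).
  - by exists r; split=> //; exact: PP'.
  - by exists P'.
  - exists (closure P'); first exact: closed_closure.
    apply/seteqP; split=> x [Tx P'x]; split=> //; first exact: subset_closure.
    exact: clT.
move=> /seteqP[_ /(_ z (jonesT1xx z))[_ P'z]].
by apply: Zz; left.
Qed.

(** Around a point [x] outside [M] there is a continuum [W] off [M]. The complement of [W°] is an
    upper set whose connected subsets [T [set y]] all reach the connected set [M], so it is a
    continuum. A maximal point above [x] is interior to it, hence so is [x], although [x] is in
    [W°]. *)
Lemma jonesT_max_full : T M `<=` M -> M = setT.
Proof.
move=> TMM; apply/seteqP; split=> // x _; apply: contrapT => nMx.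
have /jonesTNP[W [cW Wx WM]] : ~ T M x by move/TMM.
have cWi : closed (~` W°) by apply: open_closedC; exact: open_interior.
have up y : ~ W° y -> T [set y] `<=` ~` W°.
  by move=> nWy; apply: jonesT_subC => // _ ->.
have MW : M `<=` ~` W° by move=> y My /interior_subset /WM.
have cK : subcontinuum (~` W°).
  apply: closed_subcontinuum => //; last first.
    by have [m Mm _] := jonesT_max_above x; exists m; exact: MW.
  apply: closed_connected => //.
  suff gen H K : closed H -> closed K -> K !=set0 ->
      H `<=` ~` K -> ~` W° = H `|` K -> M `<=` H -> False.
    move=> H K cH cK H0 K0 HK WE.
    have [||MH|MK] := connected_sub_closed jonesT_max_connected cH cK.
    - by rewrite -WE.
    - by move=> y [_]; exact: HK.
    - exact: (gen H K).
    - apply: (gen K H) => //; last by rewrite setUC.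
      by move=> y Ky /HK; exact.
  move=> cH cK [k Kk] HK WE MH.
  have nWk : ~ W° k by have : (~` W°) k by rewrite WE; right.
  have [||TH|TK] := connected_sub_closed (@jonesT1_connected R X k) cH cK.
  - by rewrite -WE; exact: up.
  - by move=> y [_]; exact: HK.
  - by apply: (HK k) => //; exact: TH (jonesT1xx k).
  - have [m Mm Tkm] := jonesT_max_above k.
    by apply: (HK m); [exact: MH|exact: TK].
have [m Mm Txm] := jonesT_max_above x.
have : (~` W°)° x.
  apply: (jonesT1_interior cK Txm).
  have : nbhs m (~` W).
    apply: open_nbhs_nbhs; split; last by move=> /WM.
    by apply: closed_openC; exact: subcontinuum_closed.
  by apply: filterS => y nWy /interior_subset.
by move=> /interior_subset.
Qed.

End continuous_jones.

(** * Additivity *)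

Section additivity.
Context {R : realType} {X : continuumType R}.
Implicit Types A B C D F W U V Z : set X.

Notation T := (@jonesT X).
Notation M := (@jonesT_max R X).

(** The part of [T A] in [V] would lie in [T set0]. *)
Lemma jonesT_sub_open A U V : closed A -> open U -> open V -> U `<=` ~` V ->
  T A `<=` U `|` V -> A `<=` U -> T A `<=` U.
Proof.
move=> cA oU oV UV TUV AU x TAx; apply: contrapT => nUx.
have cTA := @jonesT_closed X A.
suff : T set0 x by rewrite jonesT0.
apply: (@jonesT_separated _ _ set0 A (T A `&` ~` U) (T A `&` ~` V)) => //.
- exact: closed0.
- by apply: closedI => //; exact: open_closedC.
- by apply: closedI => //; exact: open_closedC.
- rewrite set0U -setIUr; apply/esym/setIidPl => y _.
  by have [Uy|nUy] := pselect (U y); [right; exact: UV|left].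
- by move=> y [/TUV[]// Vy _] [_]; exact.
- by move=> y Ay; split; [exact: sub_jonesT|apply: UV; exact: AU].
Qed.

Lemma jonesT_split A B U V : closed A -> closed B -> open U -> open V ->
  U `<=` ~` V -> T (A `|` B) `<=` U `|` V -> A `<=` U -> B `<=` V ->
  T (A `|` B) `<=` T A `|` T B.
Proof.
move=> cA cB oU oV UV TUV AU BV.
have cT := @jonesT_closed X (A `|` B).
have cU : closed (T (A `|` B) `&` ~` U).
  by apply: closedI => //; exact: open_closedC.
have cV : closed (T (A `|` B) `&` ~` V).
  by apply: closedI => //; exact: open_closedC.
have TE : T (A `|` B) = (T (A `|` B) `&` ~` V) `|` (T (A `|` B) `&` ~` U).
  rewrite -setIUr; apply/esym/setIidPl => y _.
  by have [Uy|nUy] := pselect (U y); [left; exact: UV|right].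
have dis : T (A `|` B) `&` ~` V `<=` ~` (T (A `|` B) `&` ~` U).
  by move=> y [/TUV[]// Uy _] [_]; exact.
have AV : A `<=` T (A `|` B) `&` ~` V.
  by move=> y Ay; split; [apply: sub_jonesT; left|apply: UV; exact: AU].
have BU : B `<=` T (A `|` B) `&` ~` U.
  move=> y By; split; first by apply: sub_jonesT; right.
  by move=> /UV; apply; exact: BV.
rewrite {1}TE => y [Cy|Dy].
  by left; apply: (jonesT_separated cA cB cV cU TE) Cy.
right; apply: (jonesT_separated cB cA cU cV _ _ BU AV) Dy.
  by rewrite setUC [RHS]setUC.
by move=> z Dz /dis; exact.
Qed.

Context (Tcont : continuous (fun A : hyperspace X => jonesT_hyper A)).

(** * Independent points and the failure of additivity *)

Lemma jonesT_pair_idem a z x : T [set x] a ->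
  T ([set z] `|` [set a]) `<=` T ([set z] `|` [set x]).
Proof.
move=> Txa; apply: (jonesT_idem Tcont) => y [->|->].
  by apply: sub_jonesT; left.
by apply: jonesTS Txa => _ ->; right.
Qed.

(** Independent points split into [jonesT_add] and [jonesT_nonadd], both open and upward closed for
    closed [A], so connected sets of independent points lie on one side. The first aim is to show
    that [jonesT_nonadd] is empty when [A] is one maximal point. *)
Definition jonesT_indep A : set X := [set z | T [set z] `<=` ~` T A].

Definition jonesT_add A : set X :=
  [set z | jonesT_indep A z /\ T (A `|` [set z]) `<=` T A `|` T [set z]].

Definition jonesT_nonadd A : set X := jonesT_indep A `\` jonesT_add A.

Notation N := jonesT_indep.
Notation Q := jonesT_add.
Notation P := jonesT_nonadd.

Lemma open_jonesT_indep A : open (N A).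
Proof. by apply: open_jonesT1_disjoint; exact: jonesT_closed. Qed.

(** Upper semicontinuity confines [T] of the enlarged set to disjoint neighbourhoods of [T A] and [T
    [set z]]; [jonesT_split] turns this into additivity. *)
Lemma open_jonesT_add A : closed A -> open (Q A).
Proof.
move=> cA; rewrite openE => z [Nz Tz].
have [U [V [oU oV AU zV UV]]] : exists U V,
    [/\ open U, open V, T A `<=` U, T [set z] `<=` V & U `<=` ~` V].
  apply: separate_closed; [exact: jonesT_closed|exact: jonesT_closed|].
  by move=> x TAx /Nz; exact.
have : nbhs z ([set z' | T (A `|` [set z']) `<=` U `|` V] `&` V).
  apply: open_nbhs_nbhs; split.
    by apply: openI => //; apply: open_jonesT_sub => //; exact: openU.
  split; last exact/zV/sub_jonesT.
  by move=> x /Tz[/AU|/zV]; [left|right].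
apply: filterS => z' [Tz' Vz'].
have AU' : A `<=` U by move=> x /sub_jonesT/AU.
have cz' := @closed_point R X z'.
split; last first.
  by apply: jonesT_split Tz' _ _ => // _ ->.
have TAU : T A `<=` U.
  apply: (jonesT_sub_open cA oU oV UV) => // x TAx; apply: Tz'.
  by apply: jonesTS TAx => y; left.
have TzV : T [set z'] `<=` V.
  apply: (jonesT_sub_open cz' oV oU).
  - by move=> x Vx /UV; exact.
  - move=> x Tx; rewrite setUC; apply: Tz'.
    by apply: jonesTS Tx => y; right.
  - by move=> _ ->.
by move=> x /TzV Vx /TAU /UV.
Qed.

(** A point exhibiting the failure persists by lower semicontinuity, while upper semicontinuity
    keeps [T [set z']] away from it. *)
Lemma open_jonesT_nonadd A : closed A -> open (P A).
Proof.
move=> cA; rewrite openE => z [Nz nQz].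
have [w Tw nw] : exists2 w, T (A `|` [set z]) w & ~ (T A `|` T [set z]) w.
  apply: contrapT => h; apply: nQz; split=> // w Tw; apply: contrapT => nw.
  by apply: h; exists w.
have cTz : closed (T A `|` T [set z]) by apply: closedU; exact: jonesT_closed.
have [U [V [oU oV AU wV UV]]] : exists U V,
    [/\ open U, open V, T A `|` T [set z] `<=` U, [set w] `<=` V & U `<=` ~` V].
  apply: separate_closed => //; first exact: closed_point.
  by move=> x Tx /= xw; apply: nw; rewrite -xw.
have : nbhs z (N A `&` [set z' | T (A `|` [set z']) `&` V !=set0] `&`
    [set z' | T [set z'] `<=` U]).
  apply: open_nbhs_nbhs; split.
    apply: openI; last exact: open_jonesT1_sub.
    by apply: openI; [exact: open_jonesT_indep|exact: open_jonesT_meet].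
  split; last by move=> x Tx; apply: AU; right.
  by split=> //; exists w; split=> //; exact: wV.
apply: filterS => z' [[Nz' [x [Tx Vx]]] TU]; split=> // -[_ /(_ x Tx)].
move=> TAz; suff /UV : U x by [].
by case: TAz => [TAx|/TU//]; apply: AU; left.
Qed.

Lemma jonesT_indep_up A z : N A z -> T [set z] `<=` N A.
Proof. by move=> Nz y Tzy x /(jonesT1_trans Tcont Tzy); exact: Nz. Qed.

Lemma jonesT_indep_split A z : closed A -> N A z ->
  T [set z] `<=` P A \/ T [set z] `<=` Q A.
Proof.
move=> cA Nz; apply: connected_sub_open.
- exact: jonesT1_connected.
- exact: open_jonesT_nonadd.
- exact: open_jonesT_add.
- move=> y /(jonesT_indep_up Nz) Ny.
  by have [Qy|nQy] := pselect (Q A y); [right|left].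
- by move=> y [_ []].
Qed.

Lemma jonesT_nonadd_up A z : closed A -> P A z -> T [set z] `<=` P A.
Proof.
move=> cA [Nz nQz]; have [//|h] := jonesT_indep_split cA Nz.
by case: nQz; apply: h; exact: jonesT1xx.
Qed.

Lemma jonesT_add_up A z : closed A -> Q A z -> T [set z] `<=` Q A.
Proof.
move=> cA Qz; have [h|//] := jonesT_indep_split cA Qz.1.
by have [_] := h z (jonesT1xx z).
Qed.

Lemma closure_jonesT_nonadd A : closed A -> closure (P A) `<=` ~` Q A.
Proof.
move=> cA; apply: closure_disjoint; first exact: open_jonesT_add.
by move=> x [].
Qed.

Lemma closure_jonesT_add A : closed A -> closure (Q A) `<=` ~` P A.
Proof.
move=> cA; apply: closure_disjoint; first exact: open_jonesT_nonadd.
by move=> x Qx [].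
Qed.

Lemma jonesT_indep_sym a z : N [set a] z -> N [set z] a.
Proof. by move=> Nz x Tax /Nz. Qed.

Lemma jonesT_add_sym a z : Q [set a] z -> Q [set z] a.
Proof.
move=> [Nz Tz]; split; first exact: jonesT_indep_sym.
by rewrite setUC [X in _ `<=` X]setUC.
Qed.

Lemma jonesT_indepxx a : ~ N [set a] a.
Proof. by move=> /(_ a (jonesT1xx a)); apply; exact: jonesT1xx. Qed.

(** In a separation with [a] and [z] on one side, the other side would lie in [T set0]; with [a] and
    [z] on different sides, additivity would hold. *)
Lemma jonesT_pair_connected a z : ~ Q [set a] z ->
  connected (T ([set a] `|` [set z])).
Proof.
move=> nQ; apply: closed_connected; first exact: jonesT_closed.
have ca := @closed_point R X a; have cz := @closed_point R X z.
suff gen H K : closed H -> closed K -> H !=set0 -> K !=set0 ->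
    H `<=` ~` K -> T ([set a] `|` [set z]) = H `|` K -> H a -> False.
  move=> H K cH cK H0 K0 HK TE.
  have : T ([set a] `|` [set z]) a by apply: sub_jonesT; left.
  rewrite TE => -[Ha|Ka]; first exact: (gen H K).
  apply: (gen K H) => //; first by move=> y Ky /HK; exact.
  by rewrite TE setUC.
move=> cH cK H0 [k Kk] HK TE Ha.
have KH : K `<=` ~` H by move=> y Ky /HK; exact.
have sub x : x = a \/ x = z -> T [set x] `<=` H `|` K.
  move=> xaz; rewrite -TE; apply: jonesTS => _ ->.
    by case: xaz => ->; [left|right].
have : T ([set a] `|` [set z]) z by apply: sub_jonesT; right.
rewrite TE => -[Hz|Kz].
  have : T set0 k.
    apply: (@jonesT_separated _ _ set0 ([set a] `|` [set z]) K H) => //.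
    - exact: closed0.
    - exact: closedU.
    - by rewrite set0U TE setUC.
    - by move=> y [->|->].
  by rewrite jonesT0.
apply: nQ; split; last first.
  rewrite TE => y [Hy|Ky]; [left|right].
    by apply: (jonesT_separated ca cz cH cK TE HK) Hy => _ ->.
  have TE' : T ([set z] `|` [set a]) = K `|` H by rewrite setUC [RHS]setUC.
  by apply: (jonesT_separated cz ca cK cH TE' KH) Ky => _ ->.
have [TaH|TaK] : T [set a] `<=` H \/ T [set a] `<=` K.
- apply: connected_sub_closed => //; first exact: jonesT1_connected.
    by apply: sub; left.
  by move=> y [_]; exact: HK.
- have [TzH|TzK] : T [set z] `<=` H \/ T [set z] `<=` K.
  + apply: connected_sub_closed => //; first exact: jonesT1_connected.
      by apply: sub; right.
    by move=> y [_]; exact: HK.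
  + by move: (TzH z (jonesT1xx z)) => /HK.
  + by move=> y /TzK Ky /TaH /HK.
- by move: (TaK a (jonesT1xx a)) => /KH.
Qed.

(** For a frontier point [y] the connected set [T [set y]] joins [y] to [a] inside the closure. So a
    part of a separation that avoids [a] has no frontier point and is clopen in [X]. *)
Lemma up_closure_connected U a : open U -> U !=set0 ->
  (forall x, U x -> T [set x] `<=` U) -> ~ U a ->
  (forall y, closure U y -> ~ U y -> T [set y] a) ->
  closure U a /\ connected (closure U).
Proof.
move=> oU U0 Uup nUa bU.
have clT y : closure U y -> T [set y] `<=` closure U.
  apply: (closure_jonesT1 Tcont); first exact: closed_closure.
  by move=> x Ux; apply: subset_trans (Uup x Ux) _; exact: subset_closure.
have Ca : closure U a.
  have [y [Cy nUy]] : exists y, closure U y /\ ~ U y.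
    apply: contrapT => h; apply: nUa; rewrite (clopen_continuum oU _ U0)//.
    move=> y Cy; apply: contrapT => nUy; apply: h.
    by exists y.
  exact: (clT y Cy a (bU y Cy nUy)).
split=> //; apply: closed_connected; first exact: closed_closure.
suff gen H K : closed H -> closed K -> K !=set0 ->
    H `<=` ~` K -> closure U = H `|` K -> H a -> False.
  move=> H K cH cK H0 K0 HK UE; move: (Ca); rewrite UE => -[Ha|Ka].
    exact: (gen H K).
  apply: (gen K H) => //; last by rewrite setUC.
  by move=> y Ky /HK; exact.
move=> cH cK K0 HK UE Ha.
have [[y [Ky nUy]]|h] := pselect (exists y, K y /\ ~ U y).
  have Cy : closure U y by rewrite UE; right.
  have [||TH|TK] := connected_sub_closed (@jonesT1_connected R X y) cH cK.
  - by rewrite -UE; exact: clT.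
  - by move=> x [_]; exact: HK.
  - by move: (TH y (jonesT1xx y)) => /HK.
  - by apply: (HK a) => //; apply: TK; exact: bU.
have KE : K = U `&` ~` H.
  apply/seteqP; split=> x.
    move=> Kx; split; last by move=> /HK.
    by apply: contrapT => nUx; apply: h; exists x.
  move=> [/subset_closure]; rewrite UE => -[//|//].
have : K a.
  rewrite (clopen_continuum _ cK K0)// KE.
  by apply: openI => //; exact: closed_openC.
exact: HK.
Qed.

Lemma jonesT_indepN a y : M a -> ~ N [set a] y -> T [set y] a.
Proof.
move=> Ma nNy; apply: contrapT => nya; apply: nNy.
exact: jonesT_max_disjoint.
Qed.

(** The closure of [Q [set a]], unless empty, is connected and contains [a]; [C] is a union of
    connected sets through [a]. Every point near [T [set a]] is in [Q [set a]] or, through its pair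
    with [a], in [C]. *)
Lemma jonesT_nbhd_continuum a U : M a -> open U -> T [set a] `<=` U ->
  exists W, [/\ subcontinuum W, T [set a] `<=` W° &
    W `<=` closure (Q [set a]) `|` closure U].
Proof.
move=> Ma oU TaU.
have ca := @closed_point R X a.
pose S := [set y | ~ Q [set a] y /\ T ([set a] `|` [set y]) `<=` U].
pose C := \bigcup_(y in S) T ([set a] `|` [set y]).
pose W := closure (Q [set a]) `|` closure C.
have nQa : ~ Q [set a] a by move=> [/jonesT_indepxx].
have Sa : S a by split=> //; rewrite setUid.
have Ca : C a by exists a => //; rewrite setUid; exact: jonesT1xx.
have coC : connected (closure C).
  apply: connected_closure; apply: bigcup_connected.
    by exists a => y _; apply: sub_jonesT; left.
  by move=> y [nQy _]; exact: jonesT_pair_connected.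
have coW : connected W.
  have [Q0|Q0] := pselect (Q [set a] !=set0).
    have [||Qa coQ] := up_closure_connected (open_jonesT_add ca) Q0 _ nQa.
    - by move=> x; exact: jonesT_add_up.
    - move=> y Qy nQy; apply: jonesT_indepN => // Ny.
      by apply: (closure_jonesT_add ca Qy).
    apply: connectedU => //; exists a; split=> //.
    exact: subset_closure.
  suff Q0' : Q [set a] = set0 by rewrite /W Q0' closure0 set0U.
  by rewrite -subset0 => x Qx; apply: Q0; exists x.
exists W; split.
- apply: closed_subcontinuum => //.
    by apply: closedU; exact: closed_closure.
  by exists a; right; exact: subset_closure.
- move=> y Tay.
  have : nbhs y [set y' | T ([set a] `|` [set y']) `<=` U].
    apply: open_nbhs_nbhs; split; first exact: open_jonesT_sub.
    apply: subset_trans TaU; apply: (jonesT_idem Tcont).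
    by move=> x [->|->//]; exact: jonesT1xx.
  apply: filterS => y' Ty'; have [Qy'|nQy'] := pselect (Q [set a] y').
    by left; exact: subset_closure.
  right; apply: subset_closure; exists y' => //.
  by apply: sub_jonesT; right.
- move=> y [Qy|Cy]; [by left|right].
  by apply: closureS Cy => x [z [_ TU] /TU].
Qed.

(* Near [T [set a]] the only points outside a small continuum are those of
   [Q [set a]]; every [y] with [a] in [T [set y]] is interior to each
   neighbourhood continuum of [a], so [y] is not on the frontier of [P]. *)
Lemma closure_jonesT_nonadd1 a : M a ->
  closure (P [set a]) `<=` P [set a] `|` T [set a].
Proof.
move=> Ma y Py; apply: contrapT => /not_orP[nPy nTy].
have ca := @closed_point R X a.
have Tya : T [set y] a.
  apply: jonesT_indepN => // Ny; apply: nPy; split=> //.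
  exact: closure_jonesT_nonadd.
have [U [V [oU oV TU yV UV]]] : exists U V,
    [/\ open U, open V, T [set a] `<=` U, [set y] `<=` V & U `<=` ~` V].
  apply: separate_closed; [exact: jonesT_closed|exact: closed_point|].
  by move=> x Tx /= xy; apply: nTy; rewrite -xy.
have [W [cW TW WQU]] := jonesT_nbhd_continuum Ma oU TU.
have Wy : W° y.
  by apply: (jonesT1_interior Tcont cW Tya); apply: TW; exact: jonesT1xx.
have /Py[z [Pz [/interior_subset Wz Vz]]] : nbhs y (W° `&` V).
  apply: open_nbhs_nbhs; split; last by split=> //; exact: yV.
  by apply: openI => //; exact: open_interior.
have [/(closure_jonesT_add ca)|] := WQU z Wz; first exact.
by move=> /(closure_disjoint oV UV).
Qed.

(** A continuum around [q] off [T [set a]] cannot cross the frontier of [P [set a]], which lies in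
    [T [set a]]; so it avoids both [a] and [z]. *)
Lemma jonesT_nonadd_pair a z : M a -> P [set a] z ->
  T ([set a] `|` [set z]) `<=` P [set a] `|` T [set a].
Proof.
move=> Ma Pz q Tq; apply: contrapT => /not_orP[nPq nTq].
have [V [cV Vq VT]] := jonesTN_sub Tcont nTq.
have [_ coV _] := cV.
have oP : open (P [set a]) by apply: open_jonesT_nonadd; exact: closed_point.
have [||VP|VnP] := connected_sub_open coV oP
    (closed_openC (@closed_closure _ (P [set a]))).
- move=> x Vx; have [Px|nPx] := pselect (P [set a] x); [by left|right].
  by move=> /(closure_jonesT_nonadd1 Ma)[//|]; exact: VT.
- by move=> x [_ Px]; apply; exact: subset_closure.
- by apply: nPq; apply: VP; exact: interior_subset.
apply: Tq; exists V; split=> // x Vx [xa|xz].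
  by apply: (VT x Vx); rewrite xa; exact: jonesT1xx.
by apply: (VnP x Vx); apply: subset_closure; rewrite xz.
Qed.

(* Otherwise [T ([set a] `|` [set z])] contains a maximal point [m] near
   [T [set a]], outside [T [set a]] and [T [set z]], for which both [a] and [z]
   lie in [P [set m]]; a continuum around [m] then avoids [a] and [z]. *)
Lemma jonesT_nonadd1_eq0 a z : M a -> ~ P [set a] z.
Proof.
move=> Ma Pz; have [Nz nQz] := Pz.
have ca := @closed_point R X a; have cz := @closed_point R X z.
have nPa : ~ P [set a] a by move=> [/jonesT_indepxx].
have [w Tw nw] : exists2 w, T ([set a] `|` [set z]) w &
    ~ (T [set a] `|` T [set z]) w.
  apply: contrapT => h; apply: nQz; split=> // w Tw; apply: contrapT => nw.
  by apply: h; exists w.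
have cTz : closed (T [set a] `|` T [set z]).
  by apply: closedU; exact: jonesT_closed.
have [U [V [oU oV TU wV UV]]] : exists U V, [/\ open U, open V,
    T [set a] `|` T [set z] `<=` U, [set w] `<=` V & U `<=` ~` V].
  apply: separate_closed => //; first exact: closed_point.
  by move=> x Tx /= xw; apply: nw; rewrite -xw.
(* [G] gathers points at which the failure of additivity with [z] is still visible in [V]. *)
pose G := N [set z] `&` [set p | T ([set z] `|` [set p]) `&` V !=set0] `&`
  [set p | T [set p] `<=` U].
have oG : open G.
  apply: openI; last exact: open_jonesT1_sub.
  by apply: openI; [exact: open_jonesT_indep|exact: open_jonesT_meet].
have TaG : T [set a] `<=` G.
  move=> p Tap; have TE := jonesT_max_eq Tcont Ma Tap; split; last first.
    by rewrite /= TE => x Tx; apply: TU; left.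
  split; first by rewrite /N /= TE; exact: jonesT_indep_sym.
  exists w; split; last exact: wV.
  by apply: (jonesT_pair_idem (Ma p Tap)); rewrite setUC.
(* The connected set [T] of the pair is covered by the open sets [P [set a]] and of points with [T]
   inside [G]. It contains [a], outside the first, and [z], in the first, so they overlap within
   it. *)
have [p [Pp [Gp Tp]]] : exists p, P [set a] p /\
    (T [set p] `<=` G /\ T ([set a] `|` [set z]) p).
  apply: contrapT => h.
  have [||TP|TG] := connected_sub_open (jonesT_pair_connected nQz)
      (open_jonesT_nonadd ca) (open_jonesT1_sub oG).
  - move=> x /(jonesT_nonadd_pair Ma Pz)[Px|Tax]; [by left|right].
    exact: subset_trans (jonesT1_trans Tcont Tax) TaG.
  - by move=> x [Tx Px] /= xG; apply: h; exists x.
  - by apply: nPa; apply: TP; apply: sub_jonesT; left.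
  - apply: h; exists z; split=> //; split; last by apply: sub_jonesT; right.
    by apply: TG; apply: sub_jonesT; right.
have [m Mm Tpm] := jonesT_max_above Tcont p.
have [[Nzm [v [Tv Vv]]] mU] := Gp m Tpm.
have Tm : T ([set a] `|` [set z]) m.
  by apply: (jonesT_idem Tcont) Tpm => _ ->.
have [Nam nQam] := jonesT_nonadd_up ca Pp Tpm.
have Pmz : P [set m] z.
  split; first exact: jonesT_indep_sym.
  move=> /jonesT_add_sym[_ /(_ v Tv)] Tzmv.
  suff /UV : U v by [].
  by case: Tzmv => [Tzv|/mU//]; apply: TU; right.
have Pma : P [set m] a.
  by split; [exact: jonesT_indep_sym|move=> /jonesT_add_sym].
have cm := @closed_point R X m.
have [U' [V' [oU' oV' TU' azV' UV']]] : exists U' V', [/\ open U', open V',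
    T [set m] `<=` U', [set a] `|` [set z] `<=` V' & U' `<=` ~` V'].
  apply: separate_closed; [exact: jonesT_closed|exact: closedU|].
  move=> x Tmx [xa|xz].
    by apply: (Nam x Tmx); rewrite xa; exact: jonesT1xx.
  by apply: (Nzm x Tmx); rewrite xz; exact: jonesT1xx.
have [W [cW TW WQU]] := jonesT_nbhd_continuum Mm oU' TU'.
apply: Tm; exists W; split=> //; first by apply: TW; exact: jonesT1xx.
(* Both [a] and [z] are in [P [set m]], hence off the closure of [Q [set m]], and [V'] keeps them
   off the closure of [U']. *)
move=> x /WQU[/(closure_jonesT_add cm) nPx|/(closure_disjoint oV' UV') nV'x]
  azx.
  by apply: nPx; case: azx => ->.
exact/nV'x/azV'.
Qed.

Lemma jonesT_max_pair a z : M a -> N [set a] z ->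
  T ([set a] `|` [set z]) `<=` T [set a] `|` T [set z].
Proof.
move=> Ma Nz; apply: contrapT => nT.
by apply: (@jonesT_nonadd1_eq0 a z Ma); split=> // -[].
Qed.

(** Induction on the length. If adding [z] breaks additivity, the set where it breaks accumulates at
    some [a] in [t]. For [z'] in that set near [a], [T] splits into a part around [a] and [z'],
    settled by the pair case, and a part around the elements outside [T [set a]], settled by
    induction; so additivity holds at [z'], a contradiction. *)
Lemma jonesT_max_seq (s : seq X) : (forall a, a \in s -> M a) ->
  forall x, T [set` s] x -> exists2 a, a \in s & T [set a] x.
Proof.
have [n] := ubnP (size s); elim: n s => // n IHn [_ _ x|z t /= szt sM x].
  rewrite (_ : [set` [::]] = set0) ?jonesT0//.
  by rewrite -subset0 => y; rewrite /= in_nil.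
set B := [set` t] => Tx.
have tM a : a \in t -> M a by move=> ta; apply: sM; rewrite inE ta orbT.
have Mz : M z by apply: sM; rewrite inE eqxx.
have cB : closed B by exact: seq_closed.
have IHt := IHn t szt tM.
have BzE : [set` z :: t] = B `|` [set z].
  apply/seteqP; split=> y /=; rewrite inE.
    by move=> /orP[/eqP ->|ty]; [right|left].
  by move=> [ty|->]; [rewrite [_ \in t]ty orbT|rewrite eqxx].
have TB a : a \in t -> T [set a] `<=` T B.
  by move=> ta; apply: jonesTS => _ ->.
have Tt y : T B y -> exists2 a, a \in z :: t & T [set a] y.
  by move=> /IHt[a ta Tay]; exists a => //; rewrite inE ta orbT.
rewrite BzE in Tx.
have [TBz|nTBz] := pselect (T B z).
  by apply/Tt/(jonesT_idem Tcont _ Tx) => y [/sub_jonesT//|->].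
have NBz : N B z.
  move=> w Tzw /IHt[a ta Taw]; apply: nTBz; apply: (TB a ta).
  by apply: (jonesT1_trans Tcont Taw); exact: Mz.
suff [_ /(_ x Tx)[/Tt//|Tzx]] : Q B z by exists z => //; rewrite inE eqxx.
apply: contrapT => nQBz; have PBz : P B z by [].
have oP := open_jonesT_nonadd cB.
have [b tb] : exists b, b \in t.
  apply: contrapT => t0; apply: nQBz; split=> //.
  rewrite (_ : B = set0) ?set0U; first by move=> y Ty; right.
  by rewrite -subset0 => b tb; apply: t0; exists b.
have nPb : ~ P B b.
  by move=> [/(_ b (jonesT1xx b)) + _]; apply; apply: sub_jonesT.
(* The nonempty open set [P B] omits [b], so by connectedness of [X] it has a frontier point; [T] of
   that point must meet [T B]. *)
have [y [Py nPy]] : exists y, closure (P B) y /\ ~ P B y.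
  apply: contrapT => h; apply: nPb.
  rewrite (clopen_continuum oP _ (ex_intro _ z PBz))// => y Py.
  by apply: contrapT => nPy; apply: h; exists y.
have nNy : ~ N B y.
  by move=> Ny; apply: nPy; split=> //; exact: closure_jonesT_nonadd.
have [w Tyw /IHt[a ta Taw]] : exists2 w, T [set y] w & T B w.
  by apply: contrapT => h; apply: nNy => w Tyw TBw; apply: h; exists w.
have Ma := tM a ta.
have Pa : closure (P B) a.
  apply: (closure_jonesT1 Tcont (@closed_closure _ _) _ Py).
    move=> v Pv; apply: subset_trans (@subset_closure _ _).
    exact: jonesT_nonadd_up.
  by apply: (jonesT1_trans Tcont Tyw); exact: Ma.
(* On maximal points the preorder is an equivalence; dropping the class of [a] makes [T [set a]]
   disjoint from [T] of the rest. *)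
pose t' := [seq c <- t | `[< ~ T [set a] c >]].
have t'P c : c \in t' <-> ~ T [set a] c /\ c \in t.
  by rewrite mem_filter; split=> [/andP[/asboolP]|[/asboolP -> ->]].
pose A := [set` t'].
have cA : closed A by exact: seq_closed.
have AB : A `<=` B by move=> c /t'P[].
have IHA : forall x, T A x -> exists2 c, c \in t' & T [set c] x.
  apply: IHn => [|c].
    have st : (size t' <= size t)%N by rewrite size_filter count_size.
    exact: leq_ltn_trans st szt.
  by move=> /t'P[_ /tM].
have [U [V [oU oV TU TV UV]]] : exists U V,
    [/\ open U, open V, T [set a] `<=` U, T A `<=` V & U `<=` ~` V].
  apply: separate_closed; [exact: jonesT_closed|exact: jonesT_closed|].
  move=> v Tav /IHA[c /t'P[nac tc] Tcv].
  apply: nac; rewrite -(jonesT_max_eq Tcont Ma Tav).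
  by rewrite (jonesT_max_eq Tcont (tM c tc) Tcv); exact: jonesT1xx.
have TBUV : T (B `|` [set a]) `<=` U `|` V.
  move=> v Tv; have /IHt[c tc Tcv] : T B v.
    apply: (jonesT_idem Tcont) Tv => u [/sub_jonesT//|->].
    by apply: sub_jonesT.
  have [Tac|nTac] := pselect (T [set a] c).
    by left; apply: TU; exact: (jonesT1_trans Tcont Tac).
  right; apply: TV; apply: jonesTS Tcv => _ ->.
  exact/t'P.
have /Pa[z' [[Nz' nQz'] [Tz' Uz']]] :
    nbhs a ([set z' | T (B `|` [set z']) `<=` U `|` V] `&` U).
  apply: open_nbhs_nbhs; split.
    by apply: openI => //; apply: open_jonesT_sub => //; exact: openU.
  by split=> //; apply: TU; exact: jonesT1xx.
apply: nQz'; split=> // v Tv.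
have caz' : closed ([set a] `|` [set z']).
  by apply: closedU; exact: closed_point.
have sBz' : ([set a] `|` [set z']) `|` A `<=` B `|` [set z'].
  by move=> u [[->|->]|/AB]; [left|right|left].
have Tazv : T (([set a] `|` [set z']) `|` A) v.
  apply: (jonesT_idem Tcont) Tv => u [tu|->].
    have [Tau|nTau] := pselect (T [set a] u).
      by apply: jonesTS Tau => _ ->; left; left.
    by apply: sub_jonesT; right; exact/t'P.
  by apply: sub_jonesT; left; right.
have [|||Taz|TAv] := jonesT_split caz' cA oU oV UV _ _ _ Tazv.
- by apply: subset_trans Tz'; exact: jonesTS.
- by move=> u [->|->//]; apply: TU; exact: jonesT1xx.
- by move=> u /sub_jonesT/TV.
- have [|Tav|Tzv] := jonesT_max_pair Ma _ Taz.
  + by move=> u /Nz' nTBu Tau; exact: (nTBu (TB a ta u Tau)).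
  + by left; exact: (TB a ta v Tav).
  + by right.
- by left; exact: jonesTS TAv.
Qed.

(** Finite subsets of the closed set [M] approximate it, and their images under [T] stay in the
    upper set [M]. *)
Lemma jonesT_max_all : M = setT.
Proof.
apply: (jonesT_max_full Tcont) => x TMx; apply: contrapT => nMx.
have cM : closed M := jonesT_max_closed Tcont.
have [||s sM [y [Ty nMy]]] := @jonesT_finite _ _ Tcont M (~` M).
- exact: closed_openC.
- by exists x; rewrite -((closure_id _).1 cM).
- have [a sa Tay] := jonesT_max_seq sM Ty.
  by apply: nMy; apply: (jonesT_max_up Tcont) Tay; exact: sM.
Qed.

Lemma jonesT1_sym x y : T [set x] y -> T [set y] x.
Proof. have : M x by rewrite jonesT_max_all. by apply. Qed.

Lemma jonesT1_eq x y : T [set x] y <-> T [set x] = T [set y].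
Proof.
split=> [Txy|->]; last exact: jonesT1xx.
apply/esym; apply: (jonesT_max_eq Tcont) Txy.
by rewrite jonesT_max_all.
Qed.

(** If [T [set x]] misses [A], so does [T [set y]] for [y] near [x]. By approximation some such [y]
    is in [T] of a finite subset of [A], hence in the class of a point of [A]. *)
Lemma jonesT_bigcup A : closed A -> T A = \bigcup_(a in A) T [set a].
Proof.
move=> cA; apply/seteqP; split=> [x TAx|x [a Aa]]; last first.
  by apply: jonesTS => _ ->.
apply: contrapT => nx.
have Vx : T [set x] `<=` ~` A.
  by move=> a Txa Aa; apply: nx; exists a => //; exact: jonesT1_sym.
have [||s sA [y [Ty yA]]] :=
    @jonesT_finite _ _ Tcont A [set x | T [set x] `<=` ~` A].
- exact: open_jonesT1_disjoint.
- by exists x; rewrite -((closure_id _).1 cA).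
- have [|a sa Tay] := @jonesT_max_seq s _ y Ty; first by rewrite jonesT_max_all.
  by apply: (yA a (jonesT1_sym Tay)); exact: sA.
Qed.

End additivity.

(** * The quotient *)

(** The continuity proof is a parameter of the type so that the continuum instance can be built from
    the type alone. *)
Definition continuum_image (R : realType) (X : continuumType R)
  (Z : metricType R) (f : X -> Z) (fcont : continuous f) : Type :=
  {z : Z | `[< range f z >]}.

HB.instance Definition _ (R : realType) (X : continuumType R)
  (Z : metricType R) (f : X -> Z) (fcont : continuous f) :=
  [Choice of continuum_image fcont by <:].

Section continuum_image.
Context {R : realType} {X : continuumType R} {Z : metricType R}.
Context {f : X -> Z} (fcont : continuous f).

Notation Y := (continuum_image fcont).

Let dist (x y : Y) : R := mdist (val x) (val y).

Let distxx x : dist x x = 0. Proof. exact: mdistxx. Qed.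

Let dist0 x y : dist x y = 0 -> x = y.
Proof. by move=> /mdist_positivity/val_inj. Qed.

Let dist_sym x y : dist x y = dist y x. Proof. exact: metric_sym. Qed.

Let dist_triangle y x z : dist x z <= dist x y + dist y z.
Proof. exact: metric_triangle. Qed.

HB.instance Definition _ :=
  @isMetric.Build R Y dist distxx dist0 dist_sym dist_triangle.

Definition to_image (x : X) : Y := exist _ (f x) (asboolT (imageT f x)).

Lemma ball_image (x y : Y) r : ball x r y = (mdist (val x) (val y) < r).
Proof. by rewrite ballEmdist. Qed.

Lemma to_image_surj (y : Y) : exists x, to_image x = y.
Proof.
have /asboolP[x _ fx] := valP y; exists x; exact: val_inj.
Qed.

Lemma to_image_continuous : continuous to_image.
Proof.
move=> x U /nbhs_ballP[r /= r0 rU].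
have fx : nbhs x (f @^-1` ball (f x) r) by exact/fcont/nbhsx_ballx.
apply: filterS fx => y fy; apply: rU; move: fy;
  by rewrite /= !ballEmdist.
Qed.

Let image_continuum : subcontinuum [set: Y].
Proof.
have [cX coX [x0 _]] := @continuumT R X.
have -> : [set: Y] = to_image @` setT.
  apply/esym/seteqP; split=> // y _.
  by have [x <-] := to_image_surj y; exists x.
split; last by exists (to_image x0), x0.
- apply: continuous_compact cX; apply: continuous_subspaceT.
  exact: to_image_continuous.
- apply: connected_continuous_connected => //; apply: continuous_subspaceT.
  exact: to_image_continuous.
Qed.

HB.instance Definition _ := @Metric_isContinuum.Build R Y image_continuum.

End continuum_image.

(** * Uniform openness and the converse implication *)

Section open_maps.
Context {R : realType} {X Y : continuumType R} (f : X -> Y).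
Context (fcont : continuous f) (fopen : open_map f).

(** Compactness makes the radius [d] independent of the point [p]. *)
Lemma open_map_uniform (e : R) : 0 < e -> exists2 d : R, 0 < d &
  forall p z, ball (f p) d z -> exists2 q, f q = z & ball p e q.
Proof.
move=> e0; have [cX _ _] := @continuumT R X.
move/compact_near_coveringP: cX => cov.
pose S (d : R) p := forall z, ball (f p) d z -> exists2 q, f q = z & ball p e q.
have : \forall d \near 0^'+, [set: X] `<=` S d.
  apply: (cov _ _ S) => p _.
  have e20 : 0 < e / 2 by rewrite divr_gt0.
  pose U := (ball p (e / 2))°.
  have Up : U p by exact: nbhsx_ballx.
  have /nbhs_ballP[r /= r0 rU] : nbhs (f p) (f @` U).
    apply: open_nbhs_nbhs; split; last by exists p.
    by apply: fopen; exact: open_interior.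
  have r20 : 0 < r / 2 by rewrite divr_gt0.
  exists (ball p (e / 2) `&` f @^-1` ball (f p) (r / 2),
      [set d | d < r / 2]) => /=.
    split; last exact: nbhs_right_lt.
    apply: filterI; first exact: nbhsx_ballx.
    exact/fcont/nbhsx_ballx.
  case=> q d [/= [pq fpq] dr] z qz.
  have /rU[w /interior_subset pw <-] : ball (f p) r z.
    rewrite (splitr r); apply: (ball_triangle fpq).
    exact: le_ball (ltW dr) _ qz.
  exists w => //; rewrite (splitr e).
  by apply: ball_triangle pw; exact: ball_sym.
move=> nS; have [d [dS d0]] := @filter_ex _ _ (at_right_proper_filter (0 : R)) _
  (filterI nS (nbhs_right_gt (0 : R))).
by exists d => // p; exact: dS.
Qed.

Lemma continuum_uniform (e : R) : 0 < e -> exists2 d : R, 0 < d &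
  forall x y, ball x d y -> ball (f x) e (f y).
Proof.
move=> e0; have [cX _ _] := @continuumT R X.
move/compact_near_coveringP: cX => cov.
pose S (d : R) x := forall y, ball x d y -> ball (f x) e (f y).
have : \forall d \near 0^'+, [set: X] `<=` S d.
  apply: (cov _ _ S) => x _.
  have e20 : 0 < e / 2 by rewrite divr_gt0.
  have /nbhs_ballP[r /= r0 rU] := fcont (nbhsx_ballx (f x) _ e20).
  have r20 : 0 < r / 2 by rewrite divr_gt0.
  exists (ball x (r / 2), [set d | d < r / 2]) => /=.
    by split; [exact: nbhsx_ballx|exact: nbhs_right_lt].
  case=> x' d [/= xx' dr] y x'y.
  have xy : ball x r y.
    rewrite (splitr r); apply: (ball_triangle xx').
    exact: le_ball (ltW dr) _ x'y.
  have xx'r : ball x r x'.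
    by apply: le_ball xx'; rewrite ler_pdivrMr// ler_pMr// ler1n.
  rewrite (splitr e); apply: ball_triangle (rU _ xy).
  by apply: ball_sym; exact: rU xx'r.
move=> nS; have [d [dS d0]] := @filter_ex _ _ (at_right_proper_filter (0 : R)) _
  (filterI nS (nbhs_right_gt (0 : R))).
by exists d => // p; exact: dS.
Qed.

(** Uniform continuity of [f] transfers closeness to the images, and uniform openness lifts it back
    to their preimages. *)
Lemma jonesT_continuous :
  (forall A : hyperspace X, jonesT A = f @^-1` (f @` A)) ->
  continuous (fun A : hyperspace X => jonesT_hyper A).
Proof.
move=> TE A U /nbhs_ballP[e /= e0 eU].
have e20 : 0 < e / 2 by rewrite divr_gt0.
have [r r0 hr] := open_map_uniform e20.
have [d d0 hd] := continuum_uniform r0.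
apply: filterS (nbhsx_ballx A d d0) => B AB; apply: eU.
rewrite ballEmdist /=; apply: (@le_lt_trans _ _ (e / 2)); last first.
  by rewrite ltr_pdivrMr// ltr_pMr// ltr1n.
move: AB; rewrite ballEmdist /= => /hausdorff_dist_lt[s sd [s0 sA sB]].
have thick (C D : hyperspace X) : C `<=` thickening D s ->
    jonesT C `<=` thickening (jonesT D) (e / 2).
  move=> CD; rewrite !TE => p [c Cc fcp]; have [b Db bc] := CD c Cc.
  have /hd fcb : ball c d b by apply: ball_sym; exact: le_ball (ltW sd) _ bc.
  have [|q fq pq] := hr p (f b); first by rewrite -fcp.
  by exists q; [exists b|exact: ball_sym].
apply: ge_inf.
  by case: (hausdorff_radii_has_inf (jonesT_hyper A) (jonesT_hyper B)).
by split=> //; exact: thick.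
Qed.

End open_maps.

(** Connected neighbourhoods that need not be open suffice, because they make the components of open
    sets open. *)
Lemma connected_nbhs_locally_connected (Y : topologicalType) :
  (forall (y : Y) U, open U -> U y ->
    exists C, [/\ nbhs y C, connected C & C `<=` U]) ->
  locally_connected Y.
Proof.
move=> h y U oU Uy; exists (connected_component U y); split.
- rewrite openE => z yz; have Uz := connected_component_sub yz.
  have [C [nC coC CU]] := h z U oU Uz.
  apply: filterS (nC) => w Cw; apply: (connected_component_trans yz).
  exact: (connected_component_max (nbhs_singleton nC) CU coC Cw).
- exact: component_connected.
- exact: connected_component_refl.
- exact: connected_component_sub.
Qed.

(** * The quotient by the sets [jonesT [set x]] *)

Section quotient.
Context {R : realType} {X : continuumType R}.
Context (Tcont : continuous (fun A : hyperspace X => jonesT_hyper A)).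

Definition hyper_point (x : X) : hyperspace X :=
  Hyperspace (@closed_point R X x) (ex_intro _ x erefl).

Lemma hyper_point_continuous : continuous hyper_point.
Proof.
move=> x U /nbhs_ballP[e /= e0 eU].
have e20 : 0 < e / 2 by rewrite divr_gt0.
apply: filterS (nbhsx_ballx x (e / 2) e20) => y xy; apply: eU.
rewrite ballEmdist /=; apply: (@le_lt_trans _ _ (e / 2)); last first.
  by rewrite ltr_pdivrMr// ltr_pMr// ltr1n.
apply: ge_inf.
  by case: (hausdorff_radii_has_inf (hyper_point x) (hyper_point y)).
split=> // z ->; [exists y|exists x] => //; exact: ball_sym.
Qed.

Definition jones_class (x : X) : hyperspace X := jonesT_hyper (hyper_point x).

Lemma jones_class_continuous : continuous jones_class.
Proof.
move=> x; apply: continuous_comp; [exact: hyper_point_continuous|exact: Tcont].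
Qed.

Notation Y := (continuum_image jones_class_continuous).
Notation q := (@to_image R X _ _ jones_class_continuous).

Lemma jones_quotient_eq x y : q x = q y <-> jonesT [set x] y.
Proof.
rewrite (jonesT1_eq Tcont); split.
  by move=> /(congr1 val)/(congr1 (@hyperset X)).
by move=> Txy; apply: val_inj; exact: hyperset_inj.
Qed.

Lemma jones_quotient_sat A : closed A -> jonesT A = q @^-1` (q @` A).
Proof.
move=> cA; rewrite (jonesT_bigcup Tcont cA); apply/seteqP.
split=> [x [a Aa Tax]|].
  by exists a => //; apply/jones_quotient_eq.
by move=> x [a Aa /jones_quotient_eq Tax]; exists a.
Qed.

Lemma jones_quotient_monotone : monotone_map q.
Proof.
move=> y; have [x <-] := to_image_surj y.
rewrite (_ : _ @^-1` _ = jonesT [set x]); first exact: jonesT1_connected.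
by apply/seteqP; split=> z; [move=> /= /esym /jones_quotient_eq|
  move=> /jones_quotient_eq /= ->].
Qed.

(** If the class of [x'] is Hausdorff-close to that of [x], it contains a point [b] close to [x],
    and [b] has the same image as [x']. *)
Lemma jones_quotient_open : open_map q.
Proof.
move=> U oU; rewrite openE => _ [x Ux <-].
have /nbhs_ballP[r /= r0 rU] : nbhs x U by exact: open_nbhs_nbhs.
apply/nbhs_ballP; exists r => // y; have [x' <-] := to_image_surj y.
rewrite ball_image => /hausdorff_dist_lt[s sr [s0 sx _]].
have [b Tb bx] := sx x (jonesT1xx x).
exists b; last by apply/esym/jones_quotient_eq.
by apply: rU; apply: ball_sym; exact: le_ball (ltW sr) _ bx.
Qed.

(** The preimage [A] of the complement of [U] is saturated, hence fixed by [jonesT]; the image of a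
    witness around [x] off [A] is a connected neighbourhood inside [U]. *)
Lemma jones_quotient_locally_connected : locally_connected Y.
Proof.
apply: connected_nbhs_locally_connected => y U oU Uy.
have [x xy] := to_image_surj y.
pose A := q @^-1` (~` U).
have cA : closed A.
  apply: preimage_closed; last exact: open_closedC.
  by move=> ? _; exact: to_image_continuous.
have /jonesTNP[W [[_ coW _] Wx WA]] : ~ jonesT A x.
  by rewrite jones_quotient_sat// => -[a Aa qax]; apply: Aa; rewrite qax xy.
exists (q @` W); split.
- have : nbhs y (q @` W°).
    apply: open_nbhs_nbhs; split; last by exists x.
    by apply: jones_quotient_open; exact: open_interior.
  by apply: filterS => _ [w /interior_subset Ww <-]; exists w.
- apply: connected_continuous_connected => //; apply: continuous_subspaceT.
  exact: to_image_continuous.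
- by move=> _ [w /WA nAw <-]; exact: contrapT.
Qed.

End quotient.

Theorem theorem3p11 (R : realType) (X : continuumType R) :
  continuous (fun A : hyperspace X => jonesT_hyper A) <->
  exists (Y : continuumType R) (f : X -> Y),
    [/\ locally_connected Y,
        continuous f,
        monotone_map f,
        open_map f &
        forall A : hyperspace X, jonesT A = f @^-1` (f @` A)].
Proof.
split=> [Tcont|[Y [f [_ fcont _ fopen TE]]]]; last exact: jonesT_continuous TE.
exists (continuum_image (jones_class_continuous Tcont)), (to_image _); split.
- exact: jones_quotient_locally_connected.
- exact: to_image_continuous.
- exact: jones_quotient_monotone.
- exact: jones_quotient_open.
- by move=> A; apply: jones_quotient_sat; exact: hyperset_closed.
Qed.
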